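(* Let $R$ be an integral domain and $M$ a nonzero, non-simple unital $R$-module. Then: (i) $D(M)$ satisfies the first countability axiom. (ii) If $\operatorname{EC}(M^{\#})$ is countable, then $D(M)$ satisfies the second countability axiom.
   Context: For $m,n\in M$ write $m\mid n$ if $n=rm$ for some $r\in R$ (equivalently $Rn\subseteq Rm$). Put $M^{\#}=\{0\neq m\in M: Rm\neq M\}$ and define an equivalence relation on $M^{\#}$ by $m\sim n$ iff $Rm=Rn$; let $[m]$ be the class of $m$ and $\operatorname{EC}(M^{\#})=\{[m]:m\in M^{\#}\}$. For $m\in M^{\#}$ let $U_m=\{[n]\in \operatorname{EC}(M^{\#}): n\mid m\}$. The family $\{U_m\}_{m\in M^{\#}}$ is a basis of a topology on $\operatorname{EC}(M^{\#})$, called the divisor topology of $M$ and denoted $D(M)$ (also denoting the resulting space). *)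

(* Defs.v *)
From HB Require Import structures.
From mathcomp Require Export all_boot all_algebra.
From mathcomp Require Export all_classical.
From mathcomp Require Export topology.

Set Implicit Arguments.
Unset Strict Implicit.
Unset Printing Implicit Defensive.

Import GRing.Theory.

Local Open Scope classical_set_scope.
Local Open Scope ring_scope.

Section DivisorTopology.
Context (R : idomainType) (M : lmodType R).

Definition simple_module : Prop :=
  (exists m : M, m != 0) /\
  forall N : {pred M}, submod_closed N -> N =i pred1 0 \/ N =i predT.

Definition mdvd (m n : M) : Prop := exists r : R, n = r *: m.

Definition cyclic_submod (m : M) : set M := range (fun r : R => r *: m).

Definition Msharp : set M := [set m | m != 0 /\ cyclic_submod m <> setT].

Definition eqclass (m : M) : set M :=
  [set n | Msharp n /\ cyclic_submod m = cyclic_submod n].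

Definition EC : set (set M) := [set eqclass m | m in Msharp].

(* The carrier of D(M) is EC seen as a type; the alias separates its topology
   from the initial topology that set_type A has for A in a topological space. *)
Definition divisor_space : Type := set_type EC.

HB.instance Definition _ := Choice.on divisor_space.

Definition divisor_nbhd (m : M) : set divisor_space :=
  [set C | exists n : M, [/\ Msharp n, mdvd n m & set_val C = eqclass n]].

Definition divisor_base : set (set divisor_space) :=
  [set divisor_nbhd m | m in Msharp].

Lemma mdvd_cyclic (m n : M) :
  mdvd m n <-> cyclic_submod n `<=` cyclic_submod m.
Proof.
split=> [[r ->] _ [s _ <-]|nm]; first by exists (s * r); rewrite ?scalerA.
have [r _ rm] : cyclic_submod m n by apply: nm; exists 1; rewrite ?scale1r.
by exists r.
Qed.

Lemma divisor_base_cover : \bigcup_(U in divisor_base) U = setT.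
Proof.
apply/seteqP; split=> // C _; have [m Mm mC] := set_valP C.
exists (divisor_nbhd m); first by exists m.
by exists m; split=> //; apply/mdvd_cyclic.
Qed.

Lemma divisor_base_join (U V : set divisor_space) (C : divisor_space) :
  divisor_base U -> divisor_base V -> U C -> V C ->
  exists W, [/\ divisor_base W, W C & W `<=` U `&` V].
Proof.
move=> [m _ <-] [n _ <-] [k [Mk /mdvd_cyclic km Ck]] [l [_ /mdvd_cyclic ln Cl]].
have {}ln : cyclic_submod n `<=` cyclic_submod k.
  suff [_ <-] : eqclass l k by [].
  by rewrite -Cl Ck.
exists (divisor_nbhd k); split; first by exists k.
  by exists k; split=> //; apply/mdvd_cyclic.
move=> B [j [Mj /mdvd_cyclic jk Bj]].
by split; exists j; split=> //; apply/mdvd_cyclic;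
   [exact: subset_trans jk|exact: subset_trans jk].
Qed.

HB.instance Definition _ := isBaseTopological.Build divisor_space
  divisor_base_cover divisor_base_join.

End DivisorTopology.

Arguments Msharp {R} M _ : assert.
Arguments EC {R} M _ : assert.
Arguments divisor_base {R} M _ : assert.

Definition first_countable (T : topologicalType) : Prop :=
  forall x : T, exists B : set (set T),
    [/\ countable B, B `<=` nbhs x
      & forall A, nbhs x A -> exists2 V, B V & V `<=` A].

(* Main.v *)
(* D(M) is an Alexandrov space: among the open sets containing the class [m],
   the basic set U_m is the smallest one.  So {U_m} is a neighbourhood base
   at [m], and U_m depends only on [m], so the base {U_m} is no larger
   than EC(M^#). *)
Require Import Defs.

Import GRing.Theory.

Local Open Scope classical_set_scope.
Local Open Scope ring_scope.

Section DivisorSpace.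
Set Implicit Arguments.
Unset Strict Implicit.
Context (R : idomainType) (M : lmodType R).
Implicit Types (m n : M) (C : divisor_space M) (A : set (divisor_space M)).

Lemma open_divisor_nbhd m : Msharp M m -> open (divisor_nbhd m).
Proof.
move=> Mm; exists [set divisor_nbhd m]; last by rewrite bigcup_set1.
by move=> _ ->; exists m.
Qed.

Lemma divisor_nbhd_center m C :
  Msharp M m -> set_val C = eqclass m -> divisor_nbhd m C.
Proof. by move=> Mm Cm; exists m; split=> //; exists 1; rewrite scale1r. Qed.

(** Since [n] is in [Msharp M], it lies in its own class, hence in that of [m]. Without this
    hypothesis both classes could be empty and their equality would say nothing. *)
Lemma eqclass_cyclic m n :
  Msharp M n -> eqclass m = eqclass n -> cyclic_submod m = cyclic_submod n.
Proof. by move=> Mn mn; suff [] : eqclass m n by []; rewrite mn. Qed.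

Lemma divisor_nbhd_sub m n : mdvd m n -> divisor_nbhd m `<=` divisor_nbhd n.
Proof.
move=> [r ->] C [k [Mk [s ->] Ck]]; exists k; split=> //.
by exists (r * s); rewrite scalerA.
Qed.

Lemma divisor_nbhd_eq m n :
  cyclic_submod m = cyclic_submod n -> divisor_nbhd m = divisor_nbhd n.
Proof.
by move=> mn; apply/seteqP; split; apply/divisor_nbhd_sub/mdvd_cyclic;
  rewrite mn.
Qed.

Lemma open_divisor_nbhd_sub m C A :
  Msharp M m -> set_val C = eqclass m -> open A -> A C -> divisor_nbhd m `<=` A.
Proof.
move=> Mm Cm [D sD <-] [U DU UC].
have [n _ nU] := sD _ DU.
(* The basic set [U] around [C] only provides some representative [k] of [C] dividing [n]. As [k]
   and [m] generate the same submodule, $U_m = U_k$, and $U_k$ lies in $U_n = U$ by transitivity of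
   divisibility. *)
move: UC; rewrite /= -nU => -[k [Mk kn Ck]].
have km : cyclic_submod k = cyclic_submod m.
  by apply: eqclass_cyclic => //; rewrite -Ck.
rewrite -(divisor_nbhd_eq km) => B kB; exists U => //.
by rewrite /= -nU; exact: divisor_nbhd_sub kB.
Qed.

(** Both the countable local bases and the basis property are read off from this principal
    neighbourhood filter. *)
Lemma nbhs_divisor_spaceE m C A :
  Msharp M m -> set_val C = eqclass m -> nbhs C A <-> divisor_nbhd m `<=` A.
Proof.
move=> Mm Cm; rewrite nbhsE; split=> [[B [oB BC] BA]|mA].
  exact: subset_trans (open_divisor_nbhd_sub Mm Cm oB BC) BA.
exists (divisor_nbhd m) => //; split; first exact: open_divisor_nbhd.
exact: divisor_nbhd_center.
Qed.

Lemma divisor_space_first_countable : first_countable (divisor_space M).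
Proof.
move=> C; have [m Mm mC] := set_valP C.
have nbC A := nbhs_divisor_spaceE A Mm (esym mC).
exists [set divisor_nbhd m]; split; first exact: countable1.
  by move=> _ ->; apply/nbC.
by move=> A /nbC mA; exists (divisor_nbhd m).
Qed.

Lemma divisor_base_basis : basis (divisor_base M).
Proof.
split=> [_ [m Mm <-]|C A]; first exact: open_divisor_nbhd.
have [m Mm mC] := set_valP C.
move=> /(nbhs_divisor_spaceE A Mm (esym mC)) mA.
exists (divisor_nbhd m) => //; split; first by exists m.
exact: divisor_nbhd_center.
Qed.

Lemma divisor_base_card_le : (divisor_base M #<= EC M)%card.
Proof.
(* Taking the union over all representatives in [X] defines a map from classes to basic sets without
   choosing one; the sets united coincide, so the class of $m$ is sent to $U_m$. *)
suff -> : divisor_base M = [set \bigcup_(m in X) divisor_nbhd m | X in EC M].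
  exact: card_image_le.
rewrite /EC image_comp; apply: eq_imagel => m Mm /=.
apply/seteqP; split=> [C mC|C [n [_ mn]]]; first by exists m.
by rewrite (divisor_nbhd_eq mn).
Qed.

End DivisorSpace.

Theorem proposition6 (R : idomainType) (M : lmodType R)
    (M_neq0 : exists m : M, m != 0) (M_nonsimple : ~ simple_module M) :
  first_countable (divisor_space M) /\
  (countable (EC M) -> @second_countable (divisor_space M)).
Proof.
split; first exact: divisor_space_first_countable.
move=> cEC; exists (divisor_base M); last exact: divisor_base_basis.
exact: sub_countable (divisor_base_card_le M) cEC.
Qed.
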